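(* Let $K$ be a field, $S=K[x_1,\ldots,x_n]$, and let $I\subset S$ be a monomial ideal with linear quotients. Then $I_{[a]}$ has linear quotients for all $a$.
   Context: For a monomial ideal $I$, $G(I)$ denotes its unique minimal set of monomial generators. $I$ has linear quotients if there is an ordering $u_1,\ldots,u_m$ of $G(I)$ such that for each $i=2,\ldots,m$ the colon ideal $(u_1,\ldots,u_{i-1}):u_i$ is generated by a subset of the variables $\{x_1,\ldots,x_n\}$. (The zero ideal has linear quotients vacuously.) $I_{\langle a\rangle}$ denotes the ideal of $S$ generated by the degree-$a$ graded component of $I$. $I_{[a]}$ denotes the squarefree part of $I_{\langle a\rangle}$, i.e. the ideal generated by the squarefree monomials in $I_{\langle a\rangle}$; equivalently, the ideal generated by all squarefree monomials of degree $a$ in $I$. *)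

(* Defs.v *)
From mathcomp Require Import all_boot all_order all_algebra.
From mathcomp Require Import mpoly.

Set Implicit Arguments.
Unset Strict Implicit.
Unset Printing Implicit Defensive.

Import GRing.Theory.
Local Open Scope ring_scope.

(* Ideals are Prop-valued predicates, equality of ideals being pointwise
   equivalence (same_set). The unit ideal is allowed, unlike with the
   idealr_closed predicates of ring_quotient. *)

Definition same_set (T : Type) (A B : T -> Prop) : Prop :=
  forall x, A x <-> B x.

Section Ideals.
Variable R : comNzRingType.

Definition is_ideal (J : R -> Prop) : Prop :=
  [/\ J 0,
      forall f g, J f -> J g -> J (f + g)
    & forall c f, J f -> J (c * f)].

Definition ideal_gen (A : R -> Prop) (f : R) : Prop :=
  forall J, is_ideal J -> (forall g, A g -> J g) -> J f.

Definition colon (J : R -> Prop) (u : R) (f : R) : Prop := J (f * u).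

End Ideals.

Section MonomialIdeals.
Variables (K : fieldType) (n : nat).
Implicit Types (I : {mpoly K[n]} -> Prop) (U G : 'X_{1..n} -> Prop).

Definition mon_gen U : {mpoly K[n]} -> Prop :=
  ideal_gen (fun f => exists2 m, U m & f = 'X_[m]).

Definition var_gen (V : {set 'I_n}) : {mpoly K[n]} -> Prop :=
  ideal_gen (fun f => exists2 j, j \in V & f = 'X_j).

Definition monomial_ideal I : Prop := exists U, same_set I (mon_gen U).

(* G = G(I); minimality is with respect to inclusion. *)
Definition min_mon_gens I G : Prop :=
  same_set I (mon_gen G) /\
  forall G', (forall m, G' m -> G m) -> same_set I (mon_gen G') ->
    forall m, G m -> G' m.

(* The indices of s start at 0, so the predecessors of the i-th entry are take i s. *)
Definition linear_quotients I : Prop :=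
  exists s : seq 'X_{1..n},
    [/\ uniq s,
        min_mon_gens I (fun m => m \in s)
      & forall i, (0 < i < size s)%N ->
          exists V : {set 'I_n},
            same_set
              (colon (mon_gen (fun m => m \in take i s)) 'X_[nth 0%MM s i])
              (var_gen V)].

Definition degree_part (d : nat) I : {mpoly K[n]} -> Prop :=
  ideal_gen (fun f => I f /\ f \is d.-homog).

Definition squarefree_mon (m : 'X_{1..n}) : Prop := forall i, (m i <= 1)%N.

Definition squarefree_part I : {mpoly K[n]} -> Prop :=
  mon_gen (fun m => squarefree_mon m /\ I 'X_[m]).

(* I_[a]. A squarefree monomial of degree > a in I_<a> is a multiple of a
   squarefree monomial of degree a in I, so no degree condition is needed. *)
Definition squarefree_degree_part (a : nat) I : {mpoly K[n]} -> Prop :=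
  squarefree_part (degree_part a I).

End MonomialIdeals.

(* Main.v *)
Require Import Defs.
From mathcomp Require Import all_boot all_order all_algebra.
From mathcomp Require Import mpoly.

(* Let u_1, ..., u_m be the generators of I in linear quotients order. Order the
   squarefree monomials w of degree a in I by the least i with u_i | w, then by
   decreasing lexicographic order. If v comes before w, with least indices j and i:
   - if j < i, pick x_k dividing u_j : u_i and l < i with u_l : u_i = x_k. Since
     u_i does not divide u_l, some x_t divides u_i to a higher power than u_l, and
     then u_l divides w x_k / x_t;
   - if j = i, take the first x_k with different exponents in v and w, and an x_t
     dividing w but not v. Then u_i still divides w x_k / x_t.
   Either way w x_k / x_t comes before w, is squarefree, and x_k divides v : w. *)

Set Implicit Arguments.
Unset Strict Implicit.
Unset Printing Implicit Defensive.

Import GRing.Theory.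
Local Open Scope ring_scope.

(** * Membership in monomial ideals, read off supports *)

Lemma mem_ideal_gen (R : comNzRingType) (A : R -> Prop) g : A g -> ideal_gen A g.
Proof. by move=> Ag J _; apply. Qed.

Lemma ideal_gen_ideal (R : comNzRingType) (A : R -> Prop) : is_ideal (ideal_gen A).
Proof.
split=> [J [J0 _ _] _|f g Jf Jg J JI AJ|c f Jf J JI AJ] //.
  by case: (JI) => _ JD _; apply: JD; [apply: Jf | apply: Jg].
by case: (JI) => _ _ JM; apply: JM; apply: Jf.
Qed.

Lemma ideal_sum (R : comNzRingType) (J : R -> Prop) (T : eqType) (r : seq T)
    (F : T -> R) :
  is_ideal J -> (forall i, i \in r -> J (F i)) -> J (\sum_(i <- r) F i).
Proof.
case=> J0 JD _; elim: r => [|x r IHr] JF; first by rewrite big_nil.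
rewrite big_cons; apply: JD; first by apply: JF; rewrite mem_head.
by apply: IHr => i ir; apply: JF; rewrite in_cons ir orbT.
Qed.

(** The support condition defines an ideal containing the generators. Conversely, [f] is the sum of
    its terms, each a multiple of a generator. *)
Lemma mon_genP (K : fieldType) (n : nat) (U : 'X_{1..n} -> Prop) (f : {mpoly K[n]}) :
  mon_gen U f <->
  forall m, m \in msupp f -> exists2 u, U u & (u <= m)%MM.
Proof.
split=> [|Uf].
  move/(_ (fun f : {mpoly K[n]} =>
    forall m, m \in msupp f -> exists2 u, U u & (u <= m)%MM)); apply.
    split=> [m|g h Jg Jh m /msuppD_le|c g Jg m /msuppM_le].
    - by rewrite msupp0.
    - by rewrite mem_cat => /orP[/Jg|/Jh].
    - case/allpairsP=> -[m1 m2] /= [_ /Jg[u Uu le_u] ->].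
      by exists u => //; apply: (lepm_trans le_u); apply: lem_addl.
  by move=> _ [u Uu ->] m; rewrite msuppX inE => /eqP->; exists u; rewrite ?lepm_refl.
rewrite (mpolyE f); apply: (ideal_sum (ideal_gen_ideal _)) => m /Uf[u Uu le_um].
have [_ _ JM] := ideal_gen_ideal (fun f : {mpoly K[n]} => exists2 m, U m & f = 'X_[m]).
rewrite -(submK le_um) mpolyXD -mul_mpolyC mulrA.
by apply: JM; apply: mem_ideal_gen; exists u.
Qed.

Lemma mon_genX (K : fieldType) (n : nat) (U : 'X_{1..n} -> Prop) m :
  @mon_gen K n U 'X_[m] <-> exists2 u, U u & (u <= m)%MM.
Proof.
rewrite mon_genP; split=> [|Um m']; first by apply; rewrite msuppX mem_head.
by rewrite msuppX inE => /eqP->.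
Qed.

Lemma var_genP (K : fieldType) (n : nat) (V : {set 'I_n}) (f : {mpoly K[n]}) :
  var_gen V f <->
  forall m, m \in msupp f -> exists2 k, k \in V & m k != 0%N.
Proof.
have -> : var_gen V f <->
    mon_gen (fun m => exists2 k, k \in V & m = U_(k)%MM) f.
  split=> Vf; apply: Vf; try exact: ideal_gen_ideal.
    by move=> _ [k kV ->]; apply: mem_ideal_gen; exists U_(k)%MM => //; exists k.
  by move=> _ [_ [k kV ->] ->]; apply: mem_ideal_gen; exists k.
rewrite mon_genP; split=> Vf m /Vf.
  by case=> _ [k kV ->]; rewrite lep1mP => mk; exists k.
by case=> k kV mk; exists U_(k)%MM; [exists k | rewrite lep1mP].
Qed.

Lemma colon_mon_genP (K : fieldType) (n : nat) (U : 'X_{1..n} -> Prop) w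
    (f : {mpoly K[n]}) :
  colon (mon_gen U) 'X_[w] f <->
  forall m, m \in msupp f -> exists2 u, U u & (u <= w + m)%MM.
Proof.
rewrite /colon mon_genP; split=> Uf m mf.
  by apply: Uf; rewrite (perm_mem (msuppMX _ _)); apply: map_f.
by move: mf; rewrite (perm_mem (msuppMX _ _)) => /mapP[m' /Uf ? ->].
Qed.

(** * Linear quotients as a divisibility condition on exponents *)

Definition antichain n (s : seq 'X_{1..n}) : Prop :=
  {in s &, forall u v : 'X_{1..n}, (u <= v)%MM -> u = v}.

(* The monomial form of linear quotients: some [s_l] with [l < i] has
   [s_l : s_i = x_k], where [x_k] divides [s_j : s_i]. *)
Definition exchange n (s : seq 'X_{1..n}) : Prop :=
  forall i j, (j < i < size s)%N -> exists k l,
    [/\ (l < i)%N, (nth 0%MM s i k < nth 0%MM s j k)%N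
      & (nth 0%MM s l <= nth 0%MM s i + U_(k))%MM].

Lemma min_mon_gensP (K : fieldType) (n : nat) (I : {mpoly K[n]} -> Prop)
    (s : seq 'X_{1..n}) :
  min_mon_gens I (fun m => m \in s) <->
  same_set I (mon_gen (fun m => m \in s)) /\ antichain s.
Proof.
split=> -[Is mins]; split=> //.
  move=> u v us vs le_uv; apply/eqP/negPn/negP => neq_uv.
  have [m []||_] // := mins (fun m => m \in s /\ m != v) _ _ v vs; last first.
    by rewrite eqxx.
  move=> f; rewrite Is !mon_genP; split=> sf m /sf [w ws le_wm]; last first.
    by case: ws => ws _; exists w.
  have [eq_wv|] := eqVneq w v; last by exists w.
  by exists u => //; apply: lepm_trans le_wm; rewrite eq_wv.
move=> G' sG' IG' m ms; have : I 'X_[m].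
  by apply/Is/mon_genX; exists m; rewrite ?lepm_refl.
rewrite (IG' _) mon_genX => -[u G'u le_um].
by rewrite -(mins u m (sG' _ G'u) ms le_um).
Qed.

(** A colon ideal generated by variables contains the monomial s_j : s_i, hence a variable [x_k]
    dividing it; that [x_k] lies in the colon ideal is witnessed by some [s_l]. *)
Lemma linear_quotientsP (K : fieldType) (n : nat) (I : {mpoly K[n]} -> Prop) :
  linear_quotients I <-> exists s,
    [/\ uniq s, same_set I (mon_gen (fun m => m \in s)), antichain s & exchange s].
Proof.
split=> -[s].
  case=> uniq_s /min_mon_gensP[Is anti_s] lq_s; exists s; split=> // i j.
  case/andP=> lt_ji lt_is; have [|V colonV] := lq_s i.
    by rewrite lt_is (leq_ltn_trans _ lt_ji).
  have lt_js := ltn_trans lt_ji lt_is.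
  have size_take : size (take i s) = i by rewrite size_takel // ltnW.
  set w := nth _ s i in colonV *; set v := nth _ s j.
  (* The subtraction is truncated, so [v - w] is the exponent of v / gcd(v, w). *)
  have : var_gen V ('X_[v - w] : {mpoly K[n]}).
    apply/colonV/colon_mon_genP => m; rewrite msuppX inE => /eqP->.
    exists v; first by rewrite -[v](nth_take _ lt_ji) mem_nth ?size_take.
    by apply/mnm_lepP => k; rewrite mnmDE mnmBE -leq_subLR.
  case/var_genP/(_ (v - w)%MM) => [|k kV]; first by rewrite msuppX mem_head.
  rewrite mnmBE subn_eq0 -ltnNge => lt_k.
  have : colon (mon_gen (fun m => m \in take i s)) 'X_[w] ('X_k : {mpoly K[n]}).
    apply/colonV/var_genP => m; rewrite msuppX inE => /eqP->.
    by exists k; rewrite // mnm1E eqxx.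
  case/colon_mon_genP/(_ U_(k)%MM) => [|u]; first by rewrite msuppX mem_head.
  case/(nthP 0%MM) => l; rewrite size_take => lt_li <-.
  by rewrite nth_take // => le_u; exists k, l.
case=> uniq_s Is anti_s exch_s; exists s; split=> //.
  exact/min_mon_gensP.
move=> i /andP[_ lt_is]; set w := nth _ s i.
have size_take : size (take i s) = i by rewrite size_takel // ltnW.
(* All variables that lie in the colon ideal. *)
exists [set k | has (fun u : 'X_{1..n} => (u <= w + U_(k))%MM) (take i s)] => f.
rewrite colon_mon_genP var_genP; split=> sf m mf.
  have [u /(nthP 0%MM)[j]] := sf _ mf.
  rewrite size_take => lt_ji <-; rewrite nth_take // => le_jm.
  have [|k [l [lt_li lt_k le_l]]] := exch_s i j; first by rewrite lt_ji.
  exists k.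
    rewrite inE; apply/hasP; exists (nth 0%MM s l) => //.
    by rewrite -(nth_take _ lt_li) mem_nth ?size_take.
  rewrite -lt0n -(ltn_add2l (w k)) addn0.
  by apply: leq_trans lt_k _; rewrite -mnmDE; apply: (mnm_lepP le_jm).
have [k] := sf _ mf; rewrite inE => /hasP[u us le_u] mk; exists u => //.
apply: lepm_trans le_u _; apply/mnm_lepP => x; rewrite !mnmDE leq_add2l.
by apply: (mnm_lepP _ x); rewrite lep1mP.
Qed.

Lemma squarefree_degree_partP (K : fieldType) (n : nat) (I : {mpoly K[n]} -> Prop)
    (a : nat) :
  monomial_ideal I ->
  same_set (squarefree_degree_part a I)
    (mon_gen (fun m => [/\ squarefree_mon m, mdeg m = a & I 'X_[m]])).
Proof.
case=> U IU f.
have degX m : degree_part a I 'X_[m] ->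
    exists2 u : 'X_{1..n}, mdeg u = a /\ I 'X_[u] & (u <= m)%MM.
  (* Stated as membership in a monomial ideal, the goal need only be checked on the homogeneous
     generators, whose support lies in [I] since [I] is monomial. *)
  rewrite -(@mon_genX K) => Im; apply: Im; first exact: ideal_gen_ideal.
  move=> g [/IU/mon_genP Ug /dhomogP deg_g]; apply/mon_genP => m' m'g.
  exists m'; rewrite ?lepm_refl //; split; first exact: deg_g.
  by apply/IU/mon_genX; apply: Ug.
rewrite /squarefree_degree_part /squarefree_part !mon_genP.
split=> sf m /sf [u].
  case=> sq_u /degX [v [deg_v Iv] le_vu] le_um; exists v.
    by split=> // i; apply: leq_trans (sq_u i); apply: (mnm_lepP le_vu).
  exact: lepm_trans le_um.
case=> sq_u deg_u Iu le_um; exists u => //; split=> //.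
by apply: mem_ideal_gen; split=> //; rewrite dhomogX; apply/eqP.
Qed.

(** * Exchanging one variable, and the order on squarefree monomials *)

Definition swap n (w : 'X_{1..n}) (k t : 'I_n) : 'X_{1..n} := (w + U_(k) - U_(t))%MM.

Lemma swapE n (w : 'X_{1..n}) k t x : swap w k t x = (w x + (k == x) - (t == x))%N.
Proof. by rewrite mnmBE mnmDE !mnm1E. Qed.

Lemma mdeg_swap n (w : 'X_{1..n}) k t : (0 < w t)%N -> mdeg (swap w k t) = mdeg w.
Proof.
move=> wt; apply/eqP; rewrite -(eqn_add2r 1) -{1}(mdeg1 t) -mdegD submK.
  by rewrite mdegD mdeg1.
by rewrite lep1mP mnmDE -lt0n ltn_addr.
Qed.

Lemma squarefree_swap n (w : 'X_{1..n}) k t :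
  squarefree_mon w -> w k = 0%N -> squarefree_mon (swap w k t).
Proof.
move=> sq_w wk x; rewrite swapE (leq_trans (leq_subr _ _)) //.
by have [<-|_] := eqVneq k x; rewrite ?wk // addn0.
Qed.

Definition first_div n (s : seq 'X_{1..n}) (w : 'X_{1..n}) : nat :=
  find (fun u : 'X_{1..n} => (u <= w)%MM) s.

(** The monomial order compares degrees first, so on monomials of equal degree it is
    lexicographic. *)
Definition earlier n (s : seq 'X_{1..n}) (v w : 'X_{1..n}) : bool :=
  (first_div s v < first_div s w)%N
  || (first_div s v == first_div s w) && (w <= v)%O.

Lemma earlier_total n (s : seq 'X_{1..n}) : total (earlier s).
Proof.
move=> v w; rewrite /earlier; case: ltngtP => //= _.
exact: Order.TotalTheory.le_total.
Qed.

Lemma earlier_trans n (s : seq 'X_{1..n}) : transitive (earlier s).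
Proof.
move=> v u w /orP[lt_uv|/andP[/eqP eq_uv le_vu]] /orP[lt_vw|/andP[/eqP eq_vw le_wv]].
- by rewrite /earlier (ltn_trans lt_uv).
- by rewrite /earlier -eq_vw lt_uv.
- by rewrite /earlier eq_uv lt_vw.
- by rewrite /earlier eq_uv eq_vw eqxx (Order.POrderTheory.le_trans le_wv) // orbT.
Qed.

Lemma earlier_anti n (s : seq 'X_{1..n}) : antisymmetric (earlier s).
Proof.
move=> v w; rewrite /earlier; case: ltngtP => //= _ le_vw.
by apply: Order.POrderTheory.le_anti; rewrite andbC.
Qed.

(** This yields [exchange] for the sorted list: [swap w k t] divides [w] times [x_k], and [k != t]
    makes it differ from [w]. *)
Lemma earlier_swap n (s : seq 'X_{1..n}) (v w : 'X_{1..n}) :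
  antichain s -> exchange s -> squarefree_mon v -> squarefree_mon w ->
  mdeg v = mdeg w -> has (fun u : 'X_{1..n} => (u <= v)%MM) s ->
  has (fun u : 'X_{1..n} => (u <= w)%MM) s -> earlier s v w -> v != w ->
  exists k t, [/\ (w k < v k)%N, (0 < w t)%N, k != t,
    has (fun u : 'X_{1..n} => (u <= swap w k t)%MM) s & earlier s (swap w k t) w].
Proof.
move=> anti_s exch_s sq_v sq_w deg_vw has_v has_w.
pose q x := fun u : 'X_{1..n} => (u <= x)%MM.
set i := first_div s w; set j := first_div s v.
have lt_is : (i < size s)%N by rewrite -has_find.
have lt_js : (j < size s)%N by rewrite -has_find.
have le_iw : (nth 0 s i <= w)%MM := nth_find 0%MM has_w.
have le_jv : (nth 0 s j <= v)%MM := nth_find 0%MM has_v.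
have first_le x l : (l < size s)%N -> (nth 0 s l <= x)%MM ->
    has (q x) s /\ (first_div s x <= l)%N.
  move=> lt_ls le_lx; split; first by apply/hasP; exists (nth 0%MM s l);
    rewrite ?mem_nth.
  by rewrite leqNgt; apply/negP => /(before_find 0%MM) /=; rewrite le_lx.
case/orP=> [lt_ji _|/andP[/eqP eq_ji le_wv] neq_vw].
  have [|k [l [lt_li lt_k le_l]]] := exch_s i j; first by rewrite lt_ji.
  have lt_ls := ltn_trans lt_li lt_is.
  (* The index [i] is the least one whose entry divides [w]. *)
  have nle_lw : ~~ (nth 0 s l <= w)%MM.
    by apply/negP => /(first_le _ _ lt_ls)[_]; rewrite leqNgt lt_li.
  have vk := mnm_lepP le_jv k.
  (* The exponent of [x_k] in [s_j] is at most 1, because [s_j] divides the squarefree [v]. *)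
  have sik : nth 0%MM s i k = 0%N.
    by apply/eqP; rewrite -leqn0 -ltnS (leq_trans lt_k) // (leq_trans vk).
  (* Otherwise [s_i] times [x_k] would divide [w], as [x_k] does not occur in [s_i]; then so would
     [s_l]. *)
  have wk : w k = 0%N.
    apply/eqP; rewrite -leqn0 leqNgt; apply: contra nle_lw => wk.
    apply: lepm_trans le_l _; apply/mnm_lepP => x; rewrite mnmDE mnm1E.
    by have [<-|_] := eqVneq k x; rewrite ?sik // addn0; apply: (mnm_lepP le_iw).
  have [t lt_t] : exists t, (nth 0%MM s l t < nth 0%MM s i t)%N.
    apply/existsP; apply: contraT; rewrite negb_exists => /forallP le_il.
    have eq_il : nth 0%MM s i = nth 0%MM s l.
      apply: anti_s; rewrite ?mem_nth //.
      by apply/mnm_lepP => x; rewrite leqNgt.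
    by rewrite -eq_il le_iw in nle_lw.
  have lt_wt := leq_trans lt_t (mnm_lepP le_iw t).
  have wt := leq_ltn_trans (leq0n _) lt_wt.
  have neq_kt : k != t by apply: contraTneq lt_t => <-; rewrite sik.
  have le_ls : (nth 0 s l <= swap w k t)%MM.
    apply/mnm_lepP => x; rewrite swapE.
    have [<-|neq_tx] := eqVneq t x.
      by rewrite (negPf neq_kt) addn0 subn1 -ltnS prednK.
    rewrite subn0; apply: leq_trans (mnm_lepP le_l x) _.
    by rewrite mnmDE mnm1E leq_add2r; apply: (mnm_lepP le_iw).
  have [has_s le_sl] := first_le _ l lt_ls le_ls.
  exists k, t; split=> //.
  - by rewrite wk -sik (leq_trans lt_k).
  - by rewrite /earlier (leq_ltn_trans le_sl).
have lt_wv : (w < v)%O by rewrite Order.POrderTheory.lt_neqAle eq_sym neq_vw.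
have [k eq_wv lt_k] := ltmcP (esym deg_vw) lt_wv.
have wk : w k = 0%N by apply/eqP; rewrite -leqn0 -ltnS (leq_trans lt_k).
(* Degrees are equal and [v] exceeds [w] at [k], so [v] is smaller somewhere else. *)
have [t lt_t] : exists t, (v t < w t)%N.
  apply/existsP; apply: contraT; rewrite negb_exists => /forallP le_wv'.
  have : (mdeg w < mdeg v)%N.
    rewrite !mdegE (bigD1 k) //= [X in (_ < X)%N](bigD1 k) //= -addSn leq_add //.
    by apply: leq_sum => x _; rewrite leqNgt.
  by rewrite deg_vw ltnn.
have wt := leq_ltn_trans (leq0n _) lt_t.
have neq_kt : k != t by apply: contraTneq lt_t => <-; rewrite -leqNgt ltnW.
have le_is : (nth 0 s i <= swap w k t)%MM.
  apply/mnm_lepP => x; rewrite swapE.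
  have [<-|neq_tx] := eqVneq t x; last first.
    by rewrite subn0 (leq_trans (mnm_lepP le_iw x)) // leq_addr.
  (* At [t], the common divisor [s_i] of [v] and [w] has exponent at most [v t], hence below
     [w t]. *)
  have := mnm_lepP le_jv t; rewrite /j eq_ji => /leq_trans -> //.
  by rewrite (negPf neq_kt) addn0 subn1 -ltnS prednK.
have [has_s le_si] := first_le _ i lt_is le_is.
exists k, t; split=> //.
(* The least index may drop below [i], which already suffices; otherwise the lexicographic order
   decides. *)
rewrite /earlier; move: le_si; rewrite leq_eqVlt => /orP[eq_si|->//].
rewrite eq_si; apply/orP; right; apply: Order.POrderTheory.ltW.
apply/ltmcP; first by rewrite mdeg_swap.
exists k => [x lt_xk|]; last by rewrite swapE eqxx eq_sym (negPf neq_kt) subn0 addn1.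
rewrite swapE [k == x]gtn_eqF // addn0.
(* Since [v] and [w] agree before [k] but differ at [t], removing [x_t] changes nothing before
   [k]. *)
have [eq_tx|] := eqVneq t x; last by rewrite subn0.
by move: lt_t; rewrite eq_tx eq_wv // ltnn.
Qed.

Lemma mnm_degree_enum n (a : nat) (P : pred 'X_{1..n}) :
  exists2 s : seq 'X_{1..n}, uniq s &
    forall m, (m \in s) = P m && (mdeg m == a).
Proof.
exists [seq m : 'X_{1..n} <- [seq (m : 'X_{1..n}) | m : 'X_{1..n < a.+1}] |
         P m && (mdeg m == a)].
  by rewrite filter_uniq // map_inj_uniq ?enum_uniq //; apply: val_inj.
move=> m; rewrite mem_filter; case: eqP => [deg_m|]; last by rewrite andbF.
have lt_m : (mdeg m < a.+1)%N by rewrite deg_m.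
rewrite (_ : m \in _) ?andbT //; apply/mapP.
by exists (BMultinom lt_m); rewrite ?mem_enum.
Qed.

Theorem corollary2p11 (K : fieldType) (n : nat) (I : {mpoly K[n]} -> Prop)
    (hI : monomial_ideal I) (hlq : linear_quotients I) :
  forall a : nat, linear_quotients (squarefree_degree_part a I).
Proof.
move=> a; have [s [_ Is anti_s exch_s]] := (linear_quotientsP I).1 hlq.
pose div_s (m : 'X_{1..n}) := has (fun u : 'X_{1..n} => (u <= m)%MM) s.
have IX m : I 'X_[m] <-> div_s m.
  by rewrite (Is _) mon_genX; split=> [?|]; [apply/hasP | move/hasP].
have [r0 uniq_r0 mem_r0] := mnm_degree_enum a
  (fun m : 'X_{1..n} => [forall x, m x <= 1]%N && div_s m).
pose r := sort (earlier s) r0.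
have rP (m : 'X_{1..n}) :
    reflect [/\ squarefree_mon m, mdeg m = a & div_s m] (m \in r).
  rewrite mem_sort mem_r0; apply: (iffP andP).
    by case=> /andP[/forallP ? ?] /eqP.
  by case=> sq_m -> ->; rewrite andbT; split=> //; apply/forallP.
have uniq_r : uniq r by rewrite sort_uniq.
have sorted_r : sorted (earlier s) r by apply: sort_sorted; apply: earlier_total.
apply/linear_quotientsP; exists r; split=> //.
- move=> f; rewrite (squarefree_degree_partP a hI f) !mon_genP.
  split=> sf m /sf [u ru le_um]; exists u => //.
    by case: ru => ? ? /IX ?; apply/rP.
  by case/rP: ru => ? ? /IX ?.
- move=> u v /rP[_ deg_u _] /rP[_ deg_v _] le_uv.
  (* Divisibility between monomials of the same degree is equality. *)
  have := mdegD (v - u)%MM u; rewrite submK // deg_u deg_v => /eqP.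
  rewrite -{1}[a]add0n eqn_add2r eq_sym mdeg_eq0 => /eqP vu0.
  by rewrite -[v](submK le_uv) vu0 add0m.
move=> i j /andP[lt_ji lt_ir]; have lt_jr := ltn_trans lt_ji lt_ir.
set w := nth _ r i; set v := nth _ r j.
have rw : w \in r by rewrite mem_nth.
have rv : v \in r by rewrite mem_nth.
have earlier_nth x y : (x < y)%N -> (y < size r)%N ->
    earlier s (nth 0%MM r x) (nth 0%MM r y).
  move=> lt_xy lt_yr; apply: (sorted_ltn_nth (@earlier_trans n s)) => //.
  by rewrite inE (ltn_trans lt_xy).
have neq_vw : v != w by rewrite nth_uniq // ltn_eqF.
have [sq_w deg_w div_w] := rP _ rw; have [sq_v deg_v div_v] := rP _ rv.
have [||k [t [lt_k wt neq_kt div_wkt le_wkt]]] :=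
  earlier_swap anti_s exch_s sq_v sq_w _ div_v div_w _ neq_vw.
- by rewrite deg_v.
- exact: earlier_nth.
have wk : w k = 0%N by apply/eqP; rewrite -leqn0 -ltnS (leq_trans lt_k).
have : swap w k t \in r.
  by apply/rP; split; [exact: squarefree_swap | rewrite mdeg_swap |].
case/(nthP 0%MM) => l lt_lr eq_l; exists k, l; split=> //; last first.
  by rewrite eq_l; apply: lem_subr.
have neq_wl : nth 0%MM r l != w.
  rewrite eq_l; apply/eqP => /mnmP/(_ k).
  by rewrite swapE wk eqxx [t == k]eq_sym (negPf neq_kt).
(* If [l] were beyond [i], sortedness would put [w] before the swap, and antisymmetry would make
   them equal. *)
rewrite ltnNge leq_eqVlt; apply/negP => /orP[/eqP eq_il|lt_il].
  by rewrite -eq_il eqxx in neq_wl.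
move/eqP: neq_wl; apply; apply: (@earlier_anti n s).
by rewrite [X in _ && X]earlier_nth // eq_l le_wkt.
Qed.
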